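(* There exists a $4$-dimensional real Banach space $X$ satisfying the following conditions: (A) $X$ is a direct sum $X=Y_1\oplus Y_2$ of two $2$-dimensional Euclidean subspaces $Y_1$ and $Y_2$ (that is, the norm of $X$ restricted to each $Y_j$ is Euclidean), with both direct sum projections having norm $1$. (B) There exists $\varepsilon>0$ such that for any $(r,R)$ satisfying $0<r<R<\infty$ and any linear isometric embeddings $I_1:\ell_2^2\to Y_1$ and $I_2:\ell_2^2\to Y_2$, there is no $(1+\varepsilon)$-bending with parameters $(r,R)$ of $\ell_2^2$ in $X$ from $I_1$ to $I_2$.
   Context: For a direct sum $X=Y_1\oplus Y_2$, the direct sum projections are $P_1(y_1+y_2)=y_1$ and $P_2(y_1+y_2)=y_2$ ($y_j\in Y_j$). Let $X$ and $Y$ be Banach spaces and $I_1,I_2:Y\to X$ linear isometric embeddings with distinct images. For $C\in[1,\infty)$ and $0<r<R<\infty$, a map $T:Y\to X$ is called a $C$-bending of $Y$ in $X$ from $I_1$ to $I_2$ with parameters $(r,R)$ if it is a bilipschitz embedding with distortion $\mathrm{Lip}(T)\cdot\mathrm{Lip}(T^{-1}|_{T(Y)})\le C$ such that the restriction of $T$ to the ball $\{\|y\|\le r\}$ of $Y$ coincides with $I_1$ and the restriction of $T$ to the exterior $\{\|y\|\ge R\}$ of the ball of radius $R$ in $Y$ coincides with $I_2$. *)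

(* Defs.v *)
From HB Require Import structures.
From mathcomp Require Import all_boot all_order all_algebra.
From mathcomp Require Import sesquilinear ring.
From mathcomp Require Import all_classical all_reals all_analysis.

Set Implicit Arguments.
Unset Strict Implicit.
Unset Printing Implicit Defensive.

Import Order.TTheory GRing.Theory Num.Theory.
Import numFieldNormedType.Exports.

Local Open Scope classical_set_scope.
Local Open Scope ring_scope.

#[short(type="finBanachType")]
HB.structure Definition FinBanach (K : numFieldType) :=
  {V of CompleteNormedModule K V & Vector K V}.

(* The space $\ell_2^n$: an alias of 'rV[R]_n, needed because the canonical
   norm of 'rV[R]_n is the sup norm. *)
Definition l2 (R : realType) (n : nat) : Type := 'rV[R]_n.

Section l2_instances.
Variables (R : realType) (n : nat).

HB.instance Definition _ := Vector.copy (l2 R n) 'rV[R]_n.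

Definition l2norm (x : l2 R n) : R :=
  Num.sqrt (\sum_(i < n) (x : 'rV[R]_n) ord0 i ^+ 2).

Let co (x : l2 R n) (i : 'I_n) : R := (x : 'rV[R]_n) ord0 i.

Let sumsq_ge0 (f : 'I_n -> R) : 0 <= \sum_(i < n) f i ^+ 2.
Proof. by apply: sumr_ge0 => i _; exact: sqr_ge0. Qed.

Let coD x y i : co (x + y) i = co x i + co y i.
Proof. exact: mxE. Qed.

Let coB x y i : co (x - y) i = co x i - co y i.
Proof. by rewrite coD; congr (_ + _); exact: mxE. Qed.

Let cauchy_schwarz (f g : 'I_n -> R) :
  (\sum_i f i * g i) ^+ 2 <= (\sum_i f i ^+ 2) * (\sum_i g i ^+ 2).
Proof.
have : 0 <= \sum_i \sum_j (f i * g j - f j * g i) ^+ 2.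
  by apply: sumr_ge0 => i _; exact: sumsq_ge0.
have -> : \sum_i \sum_j (f i * g j - f j * g i) ^+ 2 =
    ((\sum_i f i ^+ 2) * (\sum_i g i ^+ 2)) *+ 2 - (\sum_i f i * g i) ^+ 2 *+ 2.
  rewrite expr2 !mulr_suml -!sumrMnl -sumrB.
  under [RHS]eq_bigr do rewrite !mulr_sumr -!sumrMnl -sumrB.
  have -> : \sum_i \sum_j (f i * g j - f j * g i) ^+ 2 =
     \sum_i \sum_j ((f i ^+ 2 * g j ^+ 2) *+ 2 - (f i * g i * (f j * g j)) *+ 2)
     + \sum_i \sum_j (f j ^+ 2 * g i ^+ 2 - f i ^+ 2 * g j ^+ 2).
    rewrite -big_split; apply: eq_bigr => i _; rewrite -big_split.
    by apply: eq_bigr => j _ /=; ring.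
  rewrite [X in _ + X](_ : _ = 0) ?addr0//.
  under eq_bigr do rewrite sumrB.
  by rewrite sumrB [X in X - _]exchange_big subrr.
by rewrite -mulrnBl pmulrn_lge0// subr_ge0.
Qed.

Let l2normD x y : l2norm (x + y) <= l2norm x + l2norm y.
Proof.
have sx : 0 <= l2norm x := sqrtr_ge0 _.
have sy : 0 <= l2norm y := sqrtr_ge0 _.
rewrite -(@ler_pXn2r _ 2) ?nnegrE ?addr_ge0 ?sqrtr_ge0// sqrrD !sqr_sqrtr//.
have -> : \sum_i (x + y : 'rV[R]_n) ord0 i ^+ 2 =
    \sum_i co x i ^+ 2 + (\sum_i co x i * co y i) *+ 2 + \sum_i co y i ^+ 2.
  rewrite -sumrMnl -!big_split; apply: eq_bigr => i _ /=.
  by rewrite -sqrrD -coD.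
rewrite lerD2r lerD2l lerMn2r/= -sqrtrM//.
by rewrite (le_trans (ler_norm _))// -sqrtr_sqr ler_sqrt ?mulr_ge0.
Qed.

Let l2normZ (k : R) x : l2norm (k *: x) = `|k| * l2norm x.
Proof.
rewrite -sqrtr_sqr -sqrtrM ?sqr_ge0// mulr_sumr; congr Num.sqrt.
by apply: eq_bigr => i _; rewrite -exprMn; congr (_ ^+ 2); exact: mxE.
Qed.

Let le_co_l2norm x i : `|co x i| <= l2norm x.
Proof.
rewrite -sqrtr_sqr ler_sqrt// (bigD1 i)//= lerDl sumr_ge0// => j _.
exact: sqr_ge0.
Qed.

Let l2norm_eq0 x : l2norm x = 0 -> x = 0.
Proof.
move=> x0; apply/rowP => i; have := le_co_l2norm x i.
by rewrite x0 normr_le0 => /eqP; rewrite /co => ->; rewrite mxE.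
Qed.

HB.instance Definition _ :=
  Lmodule_isNormed.Build R (l2 R n) l2normD l2normZ l2norm_eq0.

Let l2norm_le_sum x : l2norm x <= \sum_i `|co x i|.
Proof.
have s0 : 0 <= \sum_i `|co x i| by apply: sumr_ge0.
rewrite -[leRHS]ger0_norm// -sqrtr_sqr ler_sqrt ?sqr_ge0//.
rewrite expr2 mulr_suml; apply: ler_sum => i _.
rewrite -/(co x i) -real_normK ?num_real// expr2 ler_wpM2l//.
by rewrite (bigD1 i)//= lerDl sumr_ge0.
Qed.

Let l2_complete (F : set_system (l2 R n)) :
  ProperFilter F -> cauchy F -> cvg F.
Proof.
move=> FF /cauchyP Fc.
have cF i : cvg (co^~ i @ F).
  apply: cauchy_cvg; apply/cauchyP => e e0.
  have [x Fx] := Fc _ e0; exists (co x i).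
  rewrite /fmap /=; move: Fx; apply: filterS => y.
  rewrite -!ball_normE /= -coB; exact/le_lt_trans/le_co_l2norm.
pose l : l2 R n := \row_i lim (co^~ i @ F).
apply/cvg_ex; exists l; apply/cvgrPdist_le => e e0.
have d0 : 0 < e / n.+1%:R by rewrite divr_gt0.
have : \forall x \near F, forall i, `|co l i - co x i| <= e / n.+1%:R.
  apply: filter_forall => i.
  move/cvgrPdist_le: (cF i) => /(_ _ d0).
  by apply: filterS => x; rewrite /co /l mxE.
apply: filterS => x lx; apply: le_trans (l2norm_le_sum _) _.
under eq_bigr do rewrite coB.
apply: (@le_trans _ _ (\sum_(i < n) e / n.+1%:R)); first exact: ler_sum.
rewrite sumr_const card_ord -[leLHS]mulr_natr -mulrA ler_piMr ?ltW//.
by rewrite mulrC ltr_pdivrMr// mul1r ltr_nat.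
Qed.

HB.instance Definition _ := Uniform_isComplete.Build (l2 R n) l2_complete.

End l2_instances.

Lemma l2_normE (R : realType) (n : nat) (x : l2 R n) :
  `|x| = Num.sqrt (\sum_(i < n) (x : 'rV[R]_n) ord0 i ^+ 2).
Proof. by []. Qed.

Definition euclidean_subspace (R : realType) (X : finBanachType R)
    (V : {vspace X}) : Prop :=
  exists dot : {dot (subvs_of V) for (idfun : R -> R)},
    forall u : subvs_of V, `|vsval u| ^+ 2 = dot u u.

Definition isometric_embedding (R : realType) (Y X : normedModType R)
    (f : {linear Y -> X}) : Prop :=
  forall y, `|f y| = `|y|.

Definition opnorm (R : realType) (Y X : normedModType R) (f : Y -> X) :
    \bar R :=
  ereal_sup [set (`|f x|)%:E | x in [set x : Y | `|x| <= 1]].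

(* The least Lipschitz constant of f on A, +oo if f is not Lipschitz on A. *)
Definition Lip (R : realType) (Y X : normedModType R) (A : set Y)
    (f : Y -> X) : \bar R :=
  ereal_inf [set k%:E | k in [set k : R | 0 <= k /\ k.-lipschitz_A f]].

(* S ranges over the extensions to X of T^-1 : T(Y) -> Y; the values of S
   outside of T(Y) are irrelevant. *)
Definition bilipschitz_distortion_le (R : realType) (Y X : normedModType R)
    (T : Y -> X) (C : R) : Prop :=
  exists S : X -> Y, [/\ cancel T S,
    (Lip setT T < +oo)%E, (Lip (range T) S < +oo)%E
    & (Lip setT T * Lip (range T) S <= C%:E)%E].

Definition bending (R : realType) (Y X : completeNormedModType R)
    (C r rho : R) (I1 I2 : {linear Y -> X}) (T : Y -> X) : Prop :=
  [/\ bilipschitz_distortion_le T C,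
    (forall y, `|y| <= r -> T y = I1 y)
    & (forall y, rho <= `|y| -> T y = I2 y)].

(* Main.v *)
Require Import Defs.
From HB Require Import structures.
From mathcomp Require Import all_boot all_order all_algebra.
From mathcomp Require Import sesquilinear ring lra zify.
From mathcomp Require Import all_classical all_reals all_analysis.

(* Norm R^4 = {(a, b) : a, b in R^2} by
     N(a, b)^2 = |a|^2 + |b|^2 + (|a1| + |a2|) (|b1| + |b2|) / 2.
   This is half of the Euclidean norm squared plus a convex function, so N is
   uniformly convex, quantitatively as a Euclidean norm. A (1 + eps)-bilipschitz
   map T therefore almost preserves convex combinations, with an error O(sqrt
   eps) relative to the length of the segment: at every scale T is almost linear
   and isometric.
   The only Euclidean planes of N are the two summands: along any other plane
   some product |a_i| |b_j| has a kink, which the parallelogram law forbids, and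
   this is stable under small errors. But in a bending the ratio
   |P_1 T(s e)| / s goes continuously from 1 to 0, so it equals 1/2 at some
   scale s, where T would be close to a Euclidean plane of neither kind. *)

Set Implicit Arguments.
Unset Strict Implicit.
Unset Printing Implicit Defensive.

Import Order.TTheory GRing.Theory Num.Theory.
Import numFieldNormedType.Exports.

Local Open Scope classical_set_scope.
Local Open Scope ring_scope.

(** * The squared norm *)

Section qnorm_theory.
Variable R : realFieldType.
Implicit Types a b x y d l t : R.

Definition euc a1 a2 b1 b2 : R := a1 ^+ 2 + a2 ^+ 2 + b1 ^+ 2 + b2 ^+ 2.

Definition qnorm a1 a2 b1 b2 : R :=
  euc a1 a2 b1 b2 + (`|a1| + `|a2|) * (`|b1| + `|b2|) / 2.

Lemma qnormZ t a1 a2 b1 b2 :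
  qnorm (t * a1) (t * a2) (t * b1) (t * b2) = t ^+ 2 * qnorm a1 a2 b1 b2.
Proof.
rewrite /qnorm /euc !normrM -(real_normK (num_real t)) !exprMn.
rewrite -(real_normK (num_real t)); ring.
Qed.

Lemma qnorm_swapl a1 a2 b1 b2 : qnorm a2 a1 b1 b2 = qnorm a1 a2 b1 b2.
Proof. by rewrite /qnorm /euc; ring. Qed.

Lemma qnorm_swapr a1 a2 b1 b2 : qnorm a1 a2 b2 b1 = qnorm a1 a2 b1 b2.
Proof. by rewrite /qnorm /euc; ring. Qed.

Lemma qnorm_swap a1 a2 b1 b2 : qnorm b1 b2 a1 a2 = qnorm a1 a2 b1 b2.
Proof. by rewrite /qnorm /euc; ring. Qed.

Lemma euc_le_qnorm a1 a2 b1 b2 : euc a1 a2 b1 b2 <= qnorm a1 a2 b1 b2.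
Proof. by rewrite lerDl divr_ge0// mulr_ge0// addr_ge0. Qed.

Lemma cross_le_euc a1 a2 b1 b2 :
  (`|a1| + `|a2|) * (`|b1| + `|b2|) <= euc a1 a2 b1 b2.
Proof.
rewrite /euc -(real_normK (num_real a1)) -(real_normK (num_real a2)).
rewrite -(real_normK (num_real b1)) -(real_normK (num_real b2)).
move: `|a1| `|a2| `|b1| `|b2| => x y z w.
(* The first square gives 2 (x + y) (z + w) <= (x + y)^2 + (z + w)^2; the other two bound the right
   side by twice the sum of the four squares. *)
have := sqr_ge0 (x + y - z - w); have := sqr_ge0 (x - y).
by have := sqr_ge0 (z - w); nra.
Qed.

Lemma qnorm_le_euc a1 a2 b1 b2 : qnorm a1 a2 b1 b2 <= 2 * euc a1 a2 b1 b2.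
Proof.
have := cross_le_euc a1 a2 b1 b2; have : 0 <= euc a1 a2 b1 b2.
  by rewrite /euc !addr_ge0 ?sqr_ge0.
rewrite /qnorm; lra.
Qed.

Lemma sqr_sum_norm_convex l a a' b b' : 0 <= l <= 1 ->
  (`|(1 - l) * a + l * a'| + `|(1 - l) * b + l * b'|) ^+ 2 <=
  (1 - l) * (`|a| + `|b|) ^+ 2 + l * (`|a'| + `|b'|) ^+ 2.
Proof.
move=> /andP[l0 l1].
have tri x y : `|(1 - l) * x + l * y| <= (1 - l) * `|x| + l * `|y|.
  apply: le_trans (ler_normD _ _) _.
  by rewrite !normrM (ger0_norm l0) ger0_norm ?subr_ge0.
have := lerD (tri a a') (tri b b').
move: (normr_ge0 ((1 - l) * a + l * a')) (normr_ge0 ((1 - l) * b + l * b')).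
move: `|a| `|b| `|a'| `|b'| `|(1 - l) * a + l * a'| `|(1 - l) * b + l * b'|.
move=> x y x' y' p q p0 q0 h.
apply: (@le_trans _ _ (((1 - l) * (x + y) + l * (x' + y')) ^+ 2)).
  have h' : p + q <= (1 - l) * (x + y) + l * (x' + y') by lra.
  by rewrite ler_pXn2r// nnegrE ?(le_trans _ h') ?addr_ge0.
(* This product is exactly the convexity gap of the square. *)
have := mulr_ge0 (mulr_ge0 l0 (_ : 0 <= 1 - l)) (sqr_ge0 (x + y - x' - y')).
by rewrite subr_ge0 => /(_ l1); nra.
Qed.

(* [qnorm] is [euc / 2] plus a quarter of the sum of the four squared seminorms
   [(|a_i| + |b_j|)^2]. *)
Lemma qnorm_strongly_convex l a1 a2 b1 b2 c1 c2 d1 d2 : 0 <= l <= 1 ->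
  qnorm ((1 - l) * a1 + l * c1) ((1 - l) * a2 + l * c2)
        ((1 - l) * b1 + l * d1) ((1 - l) * b2 + l * d2)
    + l * (1 - l) / 2 * euc (a1 - c1) (a2 - c2) (b1 - d1) (b2 - d2) <=
  (1 - l) * qnorm a1 a2 b1 b2 + l * qnorm c1 c2 d1 d2.
Proof.
move=> hl.
have qE x y z w : qnorm x y z w = euc x y z w / 2 +
    ((`|x| + `|z|) ^+ 2 + (`|x| + `|w|) ^+ 2
   + (`|y| + `|z|) ^+ 2 + (`|y| + `|w|) ^+ 2) / 4.
  have := (real_normK (num_real x), real_normK (num_real y),
           real_normK (num_real z), real_normK (num_real w)).
  by move=> [[[h1 h2] h3] h4]; rewrite /qnorm /euc -h1 -h2 -h3 -h4; field.
have := sqr_sum_norm_convex a1 c1 b1 d1 hl.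
have := sqr_sum_norm_convex a1 c1 b2 d2 hl.
have := sqr_sum_norm_convex a2 c2 b1 d1 hl.
have := sqr_sum_norm_convex a2 c2 b2 d2 hl.
rewrite !qE /euc.
move: (`|(1 - l) * a1 + l * c1|) (`|(1 - l) * a2 + l * c2|)
  (`|(1 - l) * b1 + l * d1|) (`|(1 - l) * b2 + l * d2|) => p q r s h1 h2 h3 h4.
(* For the Euclidean half convexity has an exact remainder, which yields the [euc] term of the
   statement; the four seminorms need only plain convexity. *)
have e x y : ((1 - l) * x + l * y) ^+ 2 + l * (1 - l) * (x - y) ^+ 2
   = (1 - l) * x ^+ 2 + l * y ^+ 2 by ring.
have := (e a1 c1, e a2 c2, e b1 d1, e b2 d2) => -[[[e1 e2] e3] e4].
lra.
Qed.

(** * Parallelogram defect and almost Euclidean pairs of vectors *)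

(** Triangle inequality for two products with sum 2 (a b + a' b'). It shows that a product without a
    usable kink lowers the parallelogram defect only by a term of second order in [(a', b')]. *)
Lemma abs_mul_diff2 a a' b b' :
  2 * (`|a| * `|b|) - 2 * (`|a'| * `|b'|) <=
  `|a + a'| * `|b + b'| + `|a - a'| * `|b - b'|.
Proof.
rewrite -!normrM; have := ler_normD ((a + a') * (b + b')) ((a - a') * (b - b')).
rewrite (_ : _ + _ = 2 * (a * b + a' * b')); last by ring.
rewrite [X in X <= _]normrM ger0_norm//.
have := lerB_normD (a * b) (a' * b'); lra.
Qed.

(** Both [|a + a'|] and [|a - a'|] are at least [|a'| - |a|], and [|b + b'| + |b - b'|] is at least
    [2 |b|]. When [a] is small against [a'], the bound is of first order in [a']. *)
Lemma abs_mul_kink a a' b b' :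
  2 * ((`|a'| - `|a|) * `|b|) <=
  `|a + a'| * `|b + b'| + `|a - a'| * `|b - b'|.
Proof.
have h1 : `|a'| - `|a| <= `|a + a'| by rewrite (addrC a) lerB_normD.
have h2 : `|a'| - `|a| <= `|a - a'| by rewrite distrC lerB_dist.
have h3 : 2 * `|b| <= `|b + b'| + `|b - b'|.
  have := ler_normD (b + b') (b - b').
  by rewrite (_ : _ + _ = 2 * b); [rewrite normrM ger0_norm|ring].
have [h|h] := leP 0 (`|a'| - `|a|); last first.
  apply: (@le_trans _ _ 0); last by rewrite addr_ge0// mulr_ge0.
  by rewrite pmulr_rle0// mulr_le0_ge0// ltW.
have := ler_wpM2l h h3.
have := ler_wpM2r (normr_ge0 (b + b')) h1.
have := ler_wpM2r (normr_ge0 (b - b')) h2.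
by rewrite !mulrBl !mulrDr; lra.
Qed.

(* The defect of the parallelogram law sees the kink of [|a1||b1|] at
   [a1 = 0]. *)
Lemma qnorm_parallelogram_kink a1 a2 b1 b2 c1 c2 d1 d2 :
  `|c1| * `|b1| - 2 * (`|a1| * `|b1|) - 2 * qnorm c1 c2 d1 d2 <=
  qnorm (a1 + c1) (a2 + c2) (b1 + d1) (b2 + d2)
  + qnorm (a1 - c1) (a2 - c2) (b1 - d1) (b2 - d2)
  - 2 * qnorm a1 a2 b1 b2 - 2 * qnorm c1 c2 d1 d2.
Proof.
(* The Euclidean part of [qnorm] cancels by the parallelogram law. One product contributes its kink,
   the other three at most a loss, and all losses are absorbed by [qnorm c1 c2 d1 d2]. *)
have := abs_mul_kink a1 c1 b1 d1.
have := abs_mul_diff2 a1 c1 b2 d2.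
have := abs_mul_diff2 a2 c2 b1 d1.
have := abs_mul_diff2 a2 c2 b2 d2.
have := cross_le_euc c1 c2 d1 d2; have := euc_le_qnorm c1 c2 d1 d2.
have := mulr_ge0 (normr_ge0 c1) (normr_ge0 d1).
rewrite /qnorm /euc; lra.
Qed.

(* The linear map sending the standard basis of [R^2] to the vectors
   [(a1, a2, b1, b2)] and [(c1, c2, d1, d2)] is isometric for [qnorm] up to a
   relative error [d]. *)
Definition near_euclidean d a1 a2 b1 b2 c1 c2 d1 d2 := forall x y,
  `|qnorm (x * a1 + y * c1) (x * a2 + y * c2)
          (x * b1 + y * d1) (x * b2 + y * d2) - (x ^+ 2 + y ^+ 2)|
  <= d * (x ^+ 2 + y ^+ 2).

(** The kink estimate with the second vector scaled by [t]. The kink is linear in [t] and its loss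
    quadratic, so for [a1 = 0] a choice of [t] of order sqrt d forces [|c1| |b1|] to be O(sqrt d).
    The four evaluations of the norm err by 4 d (1 + t^2) <= 8 d in total. *)
Lemma near_euclidean_kink d t a1 a2 b1 b2 c1 c2 d1 d2 : 0 <= t <= 1 -> 0 <= d ->
  near_euclidean d a1 a2 b1 b2 c1 c2 d1 d2 ->
  t * (`|c1| * `|b1|) <= 2 * (`|a1| * `|b1|) + 2 * (1 + d) * t ^+ 2 + 8 * d.
Proof.
move=> /andP[t0 t1] d0 H.
have tt : t ^+ 2 <= 1 by rewrite expr_le1.
have := qnorm_parallelogram_kink a1 a2 b1 b2 (t * c1) (t * c2) (t * d1) (t * d2).
rewrite normrM (ger0_norm t0).
have := H 1 t; have := H 1 (- t); have := H 1 0; have := H 0 t.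
rewrite !mul1r !mul0r !addr0 !add0r !mulNr !ler_norml.
move: (qnorm (_ + _) _ _ _) (qnorm (_ - _) _ _ _) => p q.
move: (qnorm _ _ _ _) (qnorm _ _ _ _) => z h.
move=> /andP[? ?] /andP[? ?] /andP[? ?] /andP[? ?] ?.
have : d * t ^+ 2 <= d by rewrite ler_piMr.
nra.
Qed.

(* The kink of [|a1||b_j|] makes [b1] and [b2] tiny on the first vector, so that
   [a2] is large there; then the kink of [|a2||b1|], measured at the coarser
   scale 1/16, bounds [b1] on the second vector, hence on the combination with
   coefficients [(p, q)], where it should be large. *)
Lemma near_euclidean_core p q a2 b1 b2 c1 c2 d1 d2 :
  p ^+ 2 + q ^+ 2 = 1 ->
  near_euclidean ((1 / 1000) ^+ 3) 0 a2 b1 b2 c1 c2 d1 d2 ->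
  (q * c1) ^+ 2 + (p * a2 + q * c2) ^+ 2 = 1 / 4 ->
  (p * a2 + q * c2) ^+ 2 <= (q * c1) ^+ 2 ->
  `|p * b2 + q * d2| <= `|p * b1 + q * d1| -> False.
Proof.
move=> pq H ua ua12 ub12.
have p1 : `|p| <= 1.
  by rewrite -(@ler_pXn2r _ 2)// ?nnegrE// real_normK ?num_real; nra.
have q1 : `|q| <= 1.
  by rewrite -(@ler_pXn2r _ 2)// ?nnegrE// real_normK ?num_real; nra.
(* The larger of two squares with sum 1/4 is at least 1/8 > 1/9. *)
have c1_ge : 1 / 3 <= `|c1|.
  have t0 : 0 <= 1 / 3 :> R by lra.
  rewrite -(@ler_pXn2r _ 2) ?nnegrE// real_normK ?num_real//.
  have : (q * c1) ^+ 2 <= c1 ^+ 2.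
    rewrite exprMn ler_piMl ?sqr_ge0//; have := sqr_ge0 p; lra.
  lra.
have b_small b b' d d' : near_euclidean ((1 / 1000) ^+ 3) 0 a2 b b' c1 c2 d d' ->
    `|b| <= 1 / 1000.
  (* With t = 10^-4 and d = 10^-9 this gives [|c1| |b|] at most about 2.8 * 10^-4, and [|c1|] is at
     least 1/3. *)
  move=> /(@near_euclidean_kink _ ((1 / 100) ^+ 2)) K.
  have {K} := K ltac:(lra) ltac:(lra).
  rewrite normr0 mul0r mulr0 add0r => K.
  have := ler_wpM2r (normr_ge0 b) c1_ge; lra.
have b1_small : `|b1| <= 1 / 1000 by apply: b_small H.
have b2_small : `|b2| <= 1 / 1000.
  apply: (b_small _ b1 _ d1) => x y; rewrite qnorm_swapr; exact: H.
have a2_ge : 9 / 10 <= `|a2|.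
  have := H 1 0; rewrite !mul1r !mul0r !addr0 ler_norml => /andP[+ _].
  rewrite /qnorm /euc normr0 -(real_normK (num_real a2)).
  rewrite -(real_normK (num_real b1)) -(real_normK (num_real b2)).
  move: b1_small b2_small (normr_ge0 a2) (normr_ge0 b1) (normr_ge0 b2).
  move: `|a2| `|b1| `|b2| => x y z hy hz x0 y0 z0 h.
  rewrite leNgt; apply/negP => hx.
  have := ler_pM x0 x0 (ltW hx) (ltW hx); have := ler_pM y0 y0 hy hy.
  have := ler_pM z0 z0 hz hz; have := ler_pM x0 y0 (ltW hx) hy.
  have := ler_pM x0 z0 (ltW hx) hz; nra.
(* Otherwise both b-coordinates of the combination are below 4/10, and its [qnorm] is below 1/4 + 2
   (4/10)^2 + (3/4) (8/10) / 2 = 0.87, whereas it is almost 1. *)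
have ub1_ge : 4 / 10 <= `|p * b1 + q * d1|.
  have := H p q; rewrite !mulr0 add0r pq ler_norml => /andP[+ _].
  have := real_normK (num_real (p * b1 + q * d1)).
  have := real_normK (num_real (p * b2 + q * d2)).
  have : `|q * c1| + `|p * a2 + q * c2| <= 3 / 4.
    have t0 : 0 <= 3 / 4 :> R by lra.
    rewrite -(@ler_pXn2r _ 2) ?nnegrE ?addr_ge0//.
    have := real_normK (num_real (q * c1)).
    have := real_normK (num_real (p * a2 + q * c2)).
    have := sqr_ge0 (`|q * c1| - `|p * a2 + q * c2|); nra.
  rewrite /qnorm /euc.
  have : 0 <= `|q * c1| + `|p * a2 + q * c2| by rewrite addr_ge0.
  move: (normr_ge0 (p * b1 + q * d1)) (normr_ge0 (p * b2 + q * d2)) ub12.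
  move: `|p * b1 + q * d1| `|p * b2 + q * d2| (`|q * c1| + `|p * a2 + q * c2|).
  move=> y z x y0 z0 zy x0 hx <- <- h.
  rewrite leNgt; apply/negP => hy; have hz := le_lt_trans zy hy.
  have := ler_pM y0 y0 (ltW hy) (ltW hy); have := ler_pM z0 z0 (ltW hz) (ltW hz).
  have := ler_pM x0 y0 hx (ltW hy); have := ler_pM x0 z0 hx (ltW hz); nra.
have d1_ge : 39 / 100 <= `|d1|.
  have := ler_normD (p * b1) (q * d1); rewrite !normrM.
  have := ler_piMl (normr_ge0 b1) p1; have := ler_piMl (normr_ge0 d1) q1; lra.
have : near_euclidean ((1 / 1000) ^+ 3) b1 b2 a2 0 d1 d2 c2 c1.
  by move=> x y; rewrite qnorm_swapr qnorm_swap; exact: H.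
(* Here [b1] is small but not zero, so [t] must be large against 10^-3 for the kink term to exceed
   [2 |b1| |a2|], yet small enough for 2 t^2 to be negligible. *)
move=> /(@near_euclidean_kink _ (1 / 16)) K.
have {K} := K ltac:(lra) ltac:(lra).
have a2_0 := normr_ge0 a2.
have := ler_wpM2r a2_0 d1_ge; have := ler_wpM2r a2_0 b1_small; lra.
Qed.

End qnorm_theory.

(** Near-Euclideanity is invariant under rotating the pair of vectors. The rotation is chosen to
    annihilate the first coordinate of the new first vector; the old first vector becomes the
    combination studied in [near_euclidean_core]. *)
Lemma near_euclidean_mixed_false (R : rcfType) (a1 a2 b1 b2 c1 c2 d1 d2 : R) :
  near_euclidean ((1 / 1000) ^+ 3) a1 a2 b1 b2 c1 c2 d1 d2 ->
  a1 ^+ 2 + a2 ^+ 2 = 1 / 4 -> False.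
Proof.
wlog a21 : a1 a2 c1 c2 / a2 ^+ 2 <= a1 ^+ 2.
  move=> W H E; have [h|/ltW h] := leP (a2 ^+ 2) (a1 ^+ 2);
    first exact: (W _ _ _ _ h H).
  apply: (W a2 a1 c2 c1) => //; last by rewrite addrC.
  by move=> x y; rewrite qnorm_swapl; exact: H.
wlog b21 : b1 b2 d1 d2 / `|b2| <= `|b1|.
  move=> W H E; have [h|/ltW h] := leP `|b2| `|b1|;
    first exact: (W _ _ _ _ h H).
  apply: (W b2 b1 d2 d1) => //.
  by move=> x y; rewrite qnorm_swapr; exact: H.
move=> H E.
pose n := Num.sqrt (a1 ^+ 2 + c1 ^+ 2).
have nn : n ^+ 2 = a1 ^+ 2 + c1 ^+ 2 by rewrite sqr_sqrtr// addr_ge0 ?sqr_ge0.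
have n0 : n != 0.
  by apply/eqP => n0; move: nn; rewrite n0; have := sqr_ge0 c1; lra.
pose p := c1 / n; pose q := - a1 / n.
have pq : p ^+ 2 + q ^+ 2 = 1.
  rewrite /p /q !expr_div_n sqrrN -mulrDl addrC -nn divff// expf_eq0.
  by rewrite (negbTE n0).
have rot x y : p * (p * x + q * y) + - q * (- q * x + p * y) = x.
  by rewrite -[RHS]mul1r -pq; ring.
have z1 : p * a1 + q * c1 = 0 by rewrite /p /q; ring.
apply: (@near_euclidean_core R p (- q) (p * a2 + q * c2) (p * b1 + q * d1)
  (p * b2 + q * d2) (- q * a1 + p * c1) (- q * a2 + p * c2) (- q * b1 + p * d1)
  (- q * b2 + p * d2)).
- by rewrite sqrrN.
- move=> x y; have := H (x * p - y * q) (x * q + y * p).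
  rewrite (_ : (x * p - y * q) ^+ 2 + (x * q + y * p) ^+ 2 = x ^+ 2 + y ^+ 2);
    last by rewrite -[RHS]mulr1 -pq; ring.
  rewrite -[in X in _ -> X]z1; congr (`|qnorm _ _ _ _ - _| <= _); ring.
- by have := rot a1 c1; rewrite z1 mulr0 add0r => ->; rewrite rot.
- by have := rot a1 c1; rewrite z1 mulr0 add0r => ->; rewrite rot.
- by rewrite !rot.
Qed.

(** * The Banach space *)

(* The space X: quadruples ((a1, a2), (b1, b2)) normed by the square root of
   [qnorm], instead of the sup norm of the product. *)
Definition bspace (R : realType) : Type := ((R^o * R^o) * (R^o * R^o))%type.

Section bspace_instances.
Variable R : realType.

HB.instance Definition _ := Vector.copy (bspace R)
  ((R^o * R^o) * (R^o * R^o))%type.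

Implicit Types x y z : bspace R.

Definition ca1 x : R := x.1.1.
Definition ca2 x : R := x.1.2.
Definition cb1 x : R := x.2.1.
Definition cb2 x : R := x.2.2.

Lemma ca1D x y : ca1 (x + y) = ca1 x + ca1 y. Proof. by []. Qed.
Lemma ca2D x y : ca2 (x + y) = ca2 x + ca2 y. Proof. by []. Qed.
Lemma cb1D x y : cb1 (x + y) = cb1 x + cb1 y. Proof. by []. Qed.
Lemma cb2D x y : cb2 (x + y) = cb2 x + cb2 y. Proof. by []. Qed.
Lemma ca1N x : ca1 (- x) = - ca1 x. Proof. by []. Qed.
Lemma ca2N x : ca2 (- x) = - ca2 x. Proof. by []. Qed.
Lemma cb1N x : cb1 (- x) = - cb1 x. Proof. by []. Qed.
Lemma cb2N x : cb2 (- x) = - cb2 x. Proof. by []. Qed.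
Lemma ca1Z k x : ca1 (k *: x) = k * ca1 x. Proof. by []. Qed.
Lemma ca2Z k x : ca2 (k *: x) = k * ca2 x. Proof. by []. Qed.
Lemma cb1Z k x : cb1 (k *: x) = k * cb1 x. Proof. by []. Qed.
Lemma cb2Z k x : cb2 (k *: x) = k * cb2 x. Proof. by []. Qed.

Definition coordE := (ca1D, ca2D, cb1D, cb2D, ca1N, ca2N, cb1N, cb2N,
  ca1Z, ca2Z, cb1Z, cb2Z).

Lemma bspaceP x y :
  [/\ ca1 x = ca1 y, ca2 x = ca2 y, cb1 x = cb1 y & cb2 x = cb2 y] -> x = y.
Proof.
case: x y => [[? ?] [? ?]] [[? ?] [? ?]].
by rewrite /ca1 /ca2 /cb1 /cb2 /= => -[-> -> -> ->].
Qed.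

Definition Esq x : R := euc (ca1 x) (ca2 x) (cb1 x) (cb2 x).
Definition Qsq x : R := qnorm (ca1 x) (ca2 x) (cb1 x) (cb2 x).

Definition bnorm x : R := Num.sqrt (Qsq x).

Lemma Esq_ge0 x : 0 <= Esq x.
Proof. by rewrite /Esq /euc !addr_ge0 ?sqr_ge0. Qed.

Lemma Qsq_ge0 x : 0 <= Qsq x.
Proof. exact: le_trans (Esq_ge0 x) (euc_le_qnorm _ _ _ _). Qed.

Lemma bnorm_sqr x : bnorm x ^+ 2 = Qsq x.
Proof. by rewrite sqr_sqrtr// Qsq_ge0. Qed.

Lemma QsqZ k x : Qsq (k *: x) = k ^+ 2 * Qsq x.
Proof. exact: qnormZ. Qed.

Lemma EsqZ k x : Esq (k *: x) = k ^+ 2 * Esq x.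
Proof. by rewrite /Esq /euc !coordE; ring. Qed.

Lemma Esq_eq0 x : Esq x = 0 -> x = 0.
Proof.
case: x => [[a b] [c d]]; rewrite /Esq /euc /ca1 /ca2 /cb1 /cb2 /= => h.
have [a0 b0 c0 d0] := And4 (sqr_ge0 a) (sqr_ge0 b) (sqr_ge0 c) (sqr_ge0 d).
by congr ((_, _), (_, _)); apply/eqP; rewrite -sqrf_eq0; apply/eqP; lra.
Qed.

Lemma Qsq_strongly_convex l x y : 0 <= l <= 1 ->
  Qsq ((1 - l) *: x + l *: y) + l * (1 - l) / 2 * Esq (x - y) <=
  (1 - l) * Qsq x + l * Qsq y.
Proof. exact: qnorm_strongly_convex. Qed.

Lemma bnormZ k x : bnorm (k *: x) = `|k| * bnorm x.
Proof. by rewrite /bnorm QsqZ sqrtrM ?sqr_ge0// sqrtr_sqr. Qed.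

Lemma bnorm_eq0 x : bnorm x = 0 -> x = 0.
Proof.
move=> h; apply: Esq_eq0; apply/eqP; rewrite eq_le Esq_ge0 andbT.
by apply: le_trans (euc_le_qnorm _ _ _ _) _; rewrite -/(Qsq x) -bnorm_sqr h expr0n.
Qed.

(** The square root of a convex function homogeneous of degree 2 is subadditive: [x + y] is the
    convex combination, with weights [1 - l] and [l], of multiples of [x] and [y] that both have
    norm [bnorm x + bnorm y]. *)
Lemma bnormD x y : bnorm (x + y) <= bnorm x + bnorm y.
Proof.
have [nx ny] : 0 <= bnorm x /\ 0 <= bnorm y by split; exact: sqrtr_ge0.
have [/bnorm_eq0 ->|x0] := eqVneq (bnorm x) 0;
  first by rewrite add0r lerDr sqrtr_ge0.
have [/bnorm_eq0 ->|y0] := eqVneq (bnorm y) 0;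
  first by rewrite addr0 lerDl sqrtr_ge0.
have px : 0 < bnorm x by rewrite lt_def x0.
have py : 0 < bnorm y by rewrite lt_def y0.
have ps : 0 < bnorm x + bnorm y by rewrite addr_gt0.
pose l := bnorm y / (bnorm x + bnorm y).
have l1E : 1 - l = bnorm x / (bnorm x + bnorm y) by rewrite /l; field; lra.
have l0 : 0 < l by rewrite divr_gt0.
have l1 : 0 < 1 - l by rewrite l1E divr_gt0.
have l01 : 0 <= l <= 1 by lra.
have := @Qsq_strongly_convex l ((1 - l)^-1 *: x) (l^-1 *: y) l01.
rewrite !scalerA !divff ?gt_eqF// !scale1r !QsqZ -!bnorm_sqr => h.
rewrite -(@ler_pXn2r _ 2) ?nnegrE ?sqrtr_ge0 ?addr_ge0//.
have l10 : 0 <= l * (1 - l) / 2 by rewrite divr_ge0// mulr_ge0// ltW.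
apply: le_trans (le_trans _ h) _; first by rewrite lerDl mulr_ge0 ?Esq_ge0.
rewrite l1E /l le_eqVlt; apply/orP; left; apply/eqP; field.
by rewrite x0 y0 gt_eqF.
Qed.

HB.instance Definition _ :=
  Lmodule_isNormed.Build R (bspace R) bnormD bnormZ bnorm_eq0.

Lemma bspace_normE x : `|x| ^+ 2 = Qsq x.
Proof. exact: bnorm_sqr. Qed.

Lemma norm_coord_le x :
  [/\ `|ca1 x| <= `|x|, `|ca2 x| <= `|x|, `|cb1 x| <= `|x| & `|cb2 x| <= `|x|].
Proof.
have h : Esq x <= `|x| ^+ 2 by rewrite bspace_normE euc_le_qnorm.
have := And4 (sqr_ge0 (ca1 x)) (sqr_ge0 (ca2 x)) (sqr_ge0 (cb1 x)) (sqr_ge0 (cb2 x)).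
move: h; rewrite /Esq /euc => h [? ? ? ?].
by split; rewrite -(@ler_pXn2r _ 2) ?nnegrE// real_normK ?num_real//; lra.
Qed.

Lemma norm_le_coord x :
  `|x| <= 2 * (`|ca1 x| + `|ca2 x| + `|cb1 x| + `|cb2 x|).
Proof.
rewrite -(@ler_pXn2r _ 2) ?nnegrE ?mulr_ge0 ?addr_ge0// bspace_normE.
apply: le_trans (qnorm_le_euc _ _ _ _) _; rewrite /euc.
rewrite -(real_normK (num_real (ca1 x))) -(real_normK (num_real (ca2 x))).
rewrite -(real_normK (num_real (cb1 x))) -(real_normK (num_real (cb2 x))).
have := And4 (normr_ge0 (ca1 x)) (normr_ge0 (ca2 x)) (normr_ge0 (cb1 x)) (normr_ge0 (cb2 x)).
move: `|ca1 x| `|ca2 x| `|cb1 x| `|cb2 x| => a b c d [a0 b0 c0 d0].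
have := mulr_ge0 a0 b0; have := mulr_ge0 a0 c0; have := mulr_ge0 a0 d0.
have := mulr_ge0 b0 c0; have := mulr_ge0 b0 d0; have := mulr_ge0 c0 d0.
have := And4 (sqr_ge0 a) (sqr_ge0 b) (sqr_ge0 c) (sqr_ge0 d) => -[]; nra.
Qed.

Lemma bspace_complete (F : set_system (bspace R)) :
  ProperFilter F -> cauchy F -> cvg F.
Proof.
move=> FF /cauchyP Fc.
have cF (f : bspace R -> R) : (forall x y, `|f x - f y| <= `|x - y|) ->
    cvg (f @ F).
  move=> fle; apply: cauchy_cvg; apply/cauchyP => e e0.
  have [x Fx] := Fc _ e0; exists (f x).
  rewrite /fmap /=; move: Fx; apply: filterS => y.
  rewrite -!ball_normE /=; exact/le_lt_trans/fle.
have c1 : cvg (ca1 @ F) by apply: cF => x y; case: (norm_coord_le (x - y)).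
have c2 : cvg (ca2 @ F) by apply: cF => x y; case: (norm_coord_le (x - y)).
have c3 : cvg (cb1 @ F) by apply: cF => x y; case: (norm_coord_le (x - y)).
have c4 : cvg (cb2 @ F) by apply: cF => x y; case: (norm_coord_le (x - y)).
pose l : bspace R := ((lim (ca1 @ F), lim (ca2 @ F)), (lim (cb1 @ F), lim (cb2 @ F))).
apply/cvg_ex; exists l; apply/cvgrPdist_le => e e0.
(* Four coordinates, and the factor 2 of [norm_le_coord]. *)
have d0 : 0 < e / 8 by rewrite divr_gt0.
move/cvgrPdist_le: c1 => /(_ _ d0) c1; move/cvgrPdist_le: c2 => /(_ _ d0) c2.
move/cvgrPdist_le: c3 => /(_ _ d0) c3; move/cvgrPdist_le: c4 => /(_ _ d0) c4.
near=> x; apply: le_trans (norm_le_coord _) _.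
have : `|ca1 (l - x)| <= e / 8 by near: x; exact: c1.
have : `|ca2 (l - x)| <= e / 8 by near: x; exact: c2.
have : `|cb1 (l - x)| <= e / 8 by near: x; exact: c3.
have : `|cb2 (l - x)| <= e / 8 by near: x; exact: c4.
lra.
Unshelve. all: by end_near.
Qed.

HB.instance Definition _ := Uniform_isComplete.Build (bspace R) bspace_complete.

Lemma dim_bspace : \dim {: bspace R} = 4%N.
Proof. by rewrite dimvf. Qed.
End bspace_instances.

(** * The two Euclidean summands *)

Section bspace_summands.
Variable R : realType.

(** Kernels rather than spans, so that membership is an equation between coordinates. *)
Definition plane1 : {vspace bspace R} :=
  lker (linfun (snd : {linear bspace R -> (R^o * R^o)%type})).
Definition plane2 : {vspace bspace R} :=
  lker (linfun (fst : {linear bspace R -> (R^o * R^o)%type})).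

Lemma mem_plane1 x : (x \in plane1) = (x.2 == 0).
Proof. by rewrite memv_ker lfunE. Qed.

Lemma mem_plane2 x : (x \in plane2) = (x.1 == 0).
Proof. by rewrite memv_ker lfunE. Qed.

Lemma plane_cap : (plane1 :&: plane2 = 0)%VS.
Proof.
apply/eqP; rewrite -subv0; apply/subvP => x.
rewrite memv_cap mem_plane1 mem_plane2 => /andP[/eqP x2 /eqP x1].
by rewrite memv0; apply/eqP; case: x x1 x2 => /= ? ? -> ->.
Qed.

Lemma plane_split (x : bspace R) :
  (((x.1, 0) : bspace R) \in plane1) * (((0, x.2) : bspace R) \in plane2) *
  (x = (x.1, 0) + (0, x.2)).
Proof.
rewrite mem_plane1 mem_plane2 !eqxx; split=> //.
by case: x => a b; congr (_, _); rewrite /= ?addr0 ?add0r.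
Qed.

Lemma plane_add : (plane1 + plane2 = fullv)%VS.
Proof.
apply/eqP; rewrite eqEsubv subvf/=; apply/subvP => x _.
have [[x1 x2] ->] := plane_split x; exact: memv_add.
Qed.

(** Each plane meets the kernel of one coordinate projection trivially, hence embeds in R^2; as the
    dimensions add up to 4, both bounds are sharp. *)
Lemma dim_plane : \dim plane1 = 2%N /\ \dim plane2 = 2%N.
Proof.
have d1 : (\dim plane1 <= 2)%N.
  rewrite -(@limg_dim_eq _ _ _ (linfun (fst : {linear bspace R -> (R^o * R^o)%type}))).
    by apply: leq_trans (dimvS (subvf _)) _; rewrite dimvf.
  exact: plane_cap.
have d2 : (\dim plane2 <= 2)%N.
  rewrite -(@limg_dim_eq _ _ _ (linfun (snd : {linear bspace R -> (R^o * R^o)%type}))).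
    by apply: leq_trans (dimvS (subvf _)) _; rewrite dimvf.
  by rewrite capvC; exact: plane_cap.
have := dimv_disjoint_sum plane_cap; rewrite plane_add dim_bspace => d.
by split; lia.
Qed.

Lemma daddv_pi_plane (x : bspace R) :
  daddv_pi plane1 plane2 x = (x.1, 0) /\ daddv_pi plane2 plane1 x = (0, x.2).
Proof.
have : daddv_pi plane1 plane2 x + daddv_pi plane2 plane1 x = x.
  by apply: daddv_pi_add plane_cap _; rewrite plane_add memvf.
have := memv_pi plane1 plane2 x; have := memv_pi plane2 plane1 x.
rewrite mem_plane1 mem_plane2.
move: (daddv_pi plane1 plane2 x) (daddv_pi plane2 plane1 x) => [a b] [c d] /=.
by move=> /eqP -> /eqP -> <- /=; rewrite addr0 add0r.
Qed.

Lemma opnorm_eq1 (f : bspace R -> bspace R) (e : bspace R) :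
  (forall x, `|f x| <= `|x|) -> f e = e -> `|e| = 1 -> opnorm f = 1%E.
Proof.
move=> fle fe e1; apply/eqP; rewrite eq_le; apply/andP; split.
  apply: ge_ereal_sup => _ [x /= x1 <-].
  by rewrite lee_fin (le_trans (fle x)).
by apply: ereal_sup_ubound; exists e; rewrite /= ?fe e1.
Qed.

Lemma norm_plane1 (a : R^o * R^o) :
  `|(a, 0) : bspace R| ^+ 2 = a.1 ^+ 2 + a.2 ^+ 2.
Proof.
rewrite bspace_normE /Qsq /qnorm /euc /ca1 /ca2 /cb1 /cb2 /= normr0; ring.
Qed.

Lemma norm_plane2 (b : R^o * R^o) :
  `|(0, b) : bspace R| ^+ 2 = b.1 ^+ 2 + b.2 ^+ 2.
Proof.
rewrite bspace_normE /Qsq /qnorm /euc /ca1 /ca2 /cb1 /cb2 /= normr0; ring.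
Qed.

Lemma opnorm_plane :
  opnorm (daddv_pi plane1 plane2) = 1%E /\ opnorm (daddv_pi plane2 plane1) = 1%E.
Proof.
split.
- apply: (@opnorm_eq1 _ ((1, 0), 0)) => [x||].
  + rewrite (daddv_pi_plane x).1 -(@ler_pXn2r _ 2) ?nnegrE// norm_plane1.
    rewrite bspace_normE; apply: le_trans (euc_le_qnorm _ _ _ _).
    by rewrite /euc -[leRHS]addrA lerDl addr_ge0 ?sqr_ge0.
  + by rewrite (daddv_pi_plane _).1.
  + by apply/eqP; rewrite -(@eqrXn2 _ 2)// norm_plane1 /= expr0n addr0.
- apply: (@opnorm_eq1 _ (0, (1, 0))) => [x||].
  + rewrite (daddv_pi_plane x).2 -(@ler_pXn2r _ 2) ?nnegrE// norm_plane2.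
    rewrite bspace_normE; apply: le_trans (euc_le_qnorm _ _ _ _).
    by rewrite /euc -[leRHS]addrA lerDr addr_ge0 ?sqr_ge0.
  + by rewrite (daddv_pi_plane _).2.
  + by apply/eqP; rewrite -(@eqrXn2 _ 2)// norm_plane2 /= expr0n addr0.
Qed.

Section dot_product.
Variable V : {vspace bspace R}.

(** The standard dot product of R^4, restricted to [V]. It induces the norm of [V] as soon as the
    cross term of [qnorm] vanishes there. *)
Definition bdot (u v : subvs_of V) : R :=
  ca1 (vsval u) * ca1 (vsval v) + ca2 (vsval u) * ca2 (vsval v)
  + cb1 (vsval u) * cb1 (vsval v) + cb2 (vsval u) * cb2 (vsval v).

Let bdot_bilinear : bilinear_for *%R (idfun \; *%R) bdot.
Proof.
by split=> u k v w; rewrite /bdot linearP /ca1 /ca2 /cb1 /cb2 /= /GRing.scale/=; ring.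
Qed.

HB.instance Definition _ := @bilinear_isBilinear.Build R (subvs_of V)
  (subvs_of V) R *%R (idfun \; *%R) bdot bdot_bilinear.

Let bdot_sym u v : bdot u v = (-1) ^+ false * idfun (bdot v u).
Proof. by rewrite expr0 mul1r /bdot /=; ring. Qed.

HB.instance Definition _ :=
  @isHermitianSesquilinear.Build R (subvs_of V) false idfun bdot bdot_sym.

Lemma bdotE u : bdot u u = Esq (vsval u).
Proof. by rewrite /bdot /Esq /euc !expr2. Qed.

Let bdot_gt0 u : u != 0 -> 0 < bdot u u.
Proof.
move=> u0; rewrite lt_def bdotE Esq_ge0 andbT; apply: contraNN u0 => /eqP.
by move=> /Esq_eq0 h; apply/eqP/val_inj; exact: h.
Qed.

HB.instance Definition _ := @isDotProduct.Build R (subvs_of V) bdot bdot_gt0.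

Lemma euclidean_subspace_Esq :
  {in V, forall x, Qsq x = Esq x} -> euclidean_subspace V.
Proof.
move=> h; exists (bdot : {dot (subvs_of V) for idfun}) => u /=.
by rewrite bspace_normE bdotE h// subvsP.
Qed.

End dot_product.

Lemma euclidean_plane : euclidean_subspace plane1 /\ euclidean_subspace plane2.
Proof.
split; apply: euclidean_subspace_Esq => x.
- rewrite mem_plane1 /Qsq /Esq /qnorm /cb1 /cb2 => /eqP ->.
  by rewrite /= normr0 addr0 mulr0 mul0r addr0.
- rewrite mem_plane2 /Qsq /Esq /qnorm /ca1 /ca2 => /eqP ->.
  by rewrite /= normr0 addr0 !mul0r addr0.
Qed.

End bspace_summands.

(** * Bilipschitz maps are almost affine *)

(** The infimum is attained: every difference quotient is a lower bound of the admissible constants,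
    hence at most their infimum. *)
Lemma LipP (R : realType) (Y X : normedModType R) (A : set Y) (f : Y -> X) :
  (Lip A f < +oo)%E -> exists k : R, [/\ Lip A f = k%:E, 0 <= k &
    forall x y, A x -> A y -> `|f x - f y| <= k * `|x - y|].
Proof.
move=> foo.
have L0 : (0 <= Lip A f)%E by apply: le_ereal_inf_tmp => _ [k [? _] <-].
have LE : Lip A f = (fine (Lip A f))%:E by rewrite fineK// ge0_fin_numE.
exists (fine (Lip A f)); split=> //; first exact: fine_ge0.
move=> x y Ax Ay; have [->|xy] := eqVneq x y; first by rewrite !subrr !normr0 mulr0.
have d0 : 0 < `|x - y| by rewrite normr_gt0 subr_eq0.
rewrite -ler_pdivrMr// -lee_fin -LE; apply: le_ereal_inf_tmp => _ [k [_ fk] <-].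
by rewrite lee_fin ler_pdivrMr//; exact: (fk (x, y)).
Qed.

Definition approx_affine (R : realType) (Y X : normedModType R) (eta : R)
    (T : Y -> X) := forall y z (l : R), 0 <= l <= 1 ->
  `|T (l *: y + (1 - l) *: z) - (l *: T y + (1 - l) *: T z)| <= eta * `|y - z|.

(** The difference quotients of [T] over the two pieces of the segment have norm at most (1 + eps)
    d, while their convex combination [T z - T y] has norm at least d / (1 + eps). Strong convexity
    forces them to be close, and their difference is a multiple of the deviation [D] from
    affinity. *)
Lemma bilipschitz_approx_affine (R : realType) (Y : normedModType R) (eps eta : R)
    (T : Y -> bspace R) :
  0 <= eps <= 1 / 2 -> 0 <= eta -> 5 * eps <= eta ^+ 2 ->
  (forall x y, `|T x - T y| <= (1 + eps) * `|x - y|) ->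
  (forall x y, `|x - y| <= (1 + eps) * `|T x - T y|) ->
  approx_affine eta T.
Proof.
move=> /andP[e0 e1] eta0 e_eta Tlip Tinv y z l /andP[l0 l1].
have [->|ln0] := eqVneq l 0.
  by rewrite !scale0r !add0r !subr0 !scale1r subrr normr0 mulr_ge0.
have [->|ln1] := eqVneq l 1.
  by rewrite subrr !scale0r !addr0 !scale1r subrr normr0 mulr_ge0.
have {}l0 : 0 < l by rewrite lt_def ln0.
have {}l1 : 0 < 1 - l by rewrite subr_gt0 lt_def eq_sym ln1.
set m := l *: y + (1 - l) *: z; set d := `|y - z|.
have upper x x' : Qsq (T x - T x') <= (1 + 3 * eps) * `|x - x'| ^+ 2.
  rewrite -bspace_normE.
  have : `|T x - T x'| ^+ 2 <= ((1 + eps) * `|x - x'|) ^+ 2.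
    by rewrite ler_pXn2r// ?nnegrE// mulr_ge0// addr_ge0.
  rewrite exprMn => /le_trans; apply; rewrite ler_wpM2r ?sqr_ge0//; nra.
have lower : (1 - 2 * eps) * d ^+ 2 <= Qsq (T z - T y).
  rewrite -bspace_normE.
  have : d ^+ 2 <= ((1 + eps) * `|T z - T y|) ^+ 2.
    by rewrite ler_pXn2r// ?nnegrE ?mulr_ge0 ?addr_ge0// /d distrC.
  rewrite exprMn => h; have s0 := sqr_ge0 `|T z - T y|.
  apply: (@le_trans _ _ ((1 - 2 * eps) * ((1 + eps) ^+ 2 * `|T z - T y| ^+ 2))).
    by rewrite ler_wpM2l//; lra.
  rewrite mulrA ler_piMl//; nra.
have my : `|m - y| = (1 - l) * d.
  rewrite (_ : m - y = (1 - l) *: (z - y)).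
    by rewrite normrZ gtr0_norm// distrC.
  by rewrite /m scalerBr (scalerBl 1 l y) scale1r opprB addrA (addrC (_ *: z)).
have mz : `|z - m| = l * d.
  rewrite (_ : z - m = l *: (z - y)).
    by rewrite normrZ gtr0_norm// distrC.
  by rewrite /m (scalerBl 1 l z) scale1r scalerBr opprD opprB addrC -addrA subrK addrC.
have l01 : 0 <= l <= 1 by lra.
set D := T m - _.
have := Qsq_strongly_convex ((1 - l)^-1 *: (T m - T y)) (l^-1 *: (T z - T m)) l01.
rewrite !scalerA !divff ?gt_eqF// !scale1r.
rewrite (_ : T m - T y + _ = T z - T y); last by rewrite addrC subrKA.
rewrite (_ : (1 - l)^-1 *: _ - _ = (l * (1 - l))^-1 *: D); last first.
  by apply: bspaceP; rewrite /D !coordE; split; field; rewrite ln0 gt_eqF.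
rewrite EsqZ !QsqZ.
have := upper m y; have := upper z m; rewrite my mz.
move: (Qsq (T m - T y)) (Qsq (T z - T m)) => q1 q2 h2 h1.
have -> : (1 - l) * ((1 - l)^-1 ^+ 2 * q1) = q1 / (1 - l) by field; rewrite gt_eqF.
have -> : l * (l^-1 ^+ 2 * q2) = q2 / l by field.
have -> : l * (1 - l) / 2 * ((l * (1 - l))^-1 ^+ 2 * Esq D) =
    Esq D / (2 * (l * (1 - l))) by field; rewrite ln0 gt_eqF.
have {}h1 : q1 / (1 - l) <= (1 + 3 * eps) * ((1 - l) * d ^+ 2).
  by rewrite ler_pdivrMr// (le_trans h1)// le_eqVlt; apply/orP; left; apply/eqP; ring.
have {}h2 : q2 / l <= (1 + 3 * eps) * (l * d ^+ 2).
  by rewrite ler_pdivrMr// (le_trans h2)// le_eqVlt; apply/orP; left; apply/eqP; ring.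
move=> h.
(* The 5 is the gap between the factors 1 + 3 eps and 1 - 2 eps. Since 2 l (1 - l) <= 1/2 and [Qsq]
   is at most [2 * Esq], the same bound then holds for [Qsq D]. *)
have : Esq D / (2 * (l * (1 - l))) <= 5 * eps * d ^+ 2 by nra.
rewrite ler_pdivrMr ?mulr_gt0// => hD.
rewrite -(@ler_pXn2r _ 2) ?nnegrE ?mulr_ge0 ?normr_ge0// bspace_normE exprMn.
apply: le_trans (qnorm_le_euc _ _ _ _) _; rewrite -/(Esq D).
have d0 := sqr_ge0 d.
have l14 : 2 * (l * (1 - l)) <= 1 / 2 by have := sqr_ge0 (l - 1 / 2); nra.
have := ler_wpM2l (mulr_ge0 e0 d0) l14.
have := ler_wpM2r d0 e_eta; lra.
Qed.

(** The factor 2 prepares [approx_affine_linear], where a sum is the midpoint of doubled vectors.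
    Positive multiples are compared along the segment from 0 to 2 v, negative ones through the
    almost oddness of [T] at 2 v; the worst case costs 2 + 8 + 4 = 14. *)
Lemma approx_affine_homogeneous (R : realType) (Y X : normedModType R) (eta c : R)
    (T : Y -> X) (v : Y) : 0 <= eta -> `|c| <= 1 -> `|v| = 1 -> T 0 = 0 ->
  approx_affine eta T ->
  `|T ((2 * c) *: v) - (2 * c) *: T v| <= 14 * eta.
Proof.
move=> eta0 c1 v1 T0 H.
have h0 w (l : R) : 0 <= l <= 1 -> `|T (l *: w) - l *: T w| <= eta * `|w|.
  by move=> /(H w 0 l); rewrite T0 !scaler0 !addr0 subr0.
have half : 0 <= (2^-1 : R) <= 1 by lra.
have n2 : `|2 *: v| = 2 by rewrite normrZ v1 mulr1 ger0_norm.
have h1 : `|T (2 *: v) - 2 *: T v| <= 4 * eta.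
  have := h0 (2 *: v) _ half; rewrite scalerA mulVf// scale1r n2 distrC.
  rewrite -(@ler_pM2l _ 2)// -[X in X * `|_|]ger0_norm// -normrZ scalerBr scalerA.
  by rewrite divff// scale1r; lra.
have h2 : `|T (- (2 *: v)) + T (2 *: v)| <= 8 * eta.
  have := H (2 *: v) (- (2 *: v)) _ half.
  have -> : 1 - 2^-1 = 2^-1 :> R by lra.
  rewrite scalerN subrr T0 sub0r normrN -scalerDr normrZ ger0_norm//.
  by rewrite opprK -scalerDl normrZ v1 addrC ger0_norm; lra.
have [c0|c0] := leP 0 c.
  have /(h0 (2 *: v)) : 0 <= c <= 1 by rewrite c0 -(ger0_norm c0).
  rewrite scalerA (mulrC c) n2 => h3.
  have -> : T ((2 * c) *: v) - (2 * c) *: T v =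
      T ((2 * c) *: v) - c *: T (2 *: v) + c *: (T (2 *: v) - 2 *: T v).
    by rewrite scalerBr scalerA (mulrC c) addrA subrK.
  apply: le_trans (ler_normD _ _) _; rewrite normrZ.
  have := ler_piMl (normr_ge0 (T (2 *: v) - 2 *: T v)) c1; lra.
have {}c0 : 0 <= - c by rewrite oppr_ge0 ltW.
have /(h0 (- (2 *: v))) : 0 <= - c <= 1.
  by rewrite c0 -(ger0_norm c0) normrN.
rewrite scalerN scaleNr opprK scalerA (mulrC c) normrN n2 => h3.
have -> : T ((2 * c) *: v) - (2 * c) *: T v =
    T ((2 * c) *: v) - (- c) *: T (- (2 *: v))
    + (- c) *: (T (- (2 *: v)) + T (2 *: v)) + c *: (T (2 *: v) - 2 *: T v).
  rewrite scalerBr scalerDr scalerA (mulrC c) !scaleNr !addrA opprK.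
  by rewrite addrK [X in _ = X - _]addrNK.
apply: le_trans (ler_normD _ _) _; rewrite normrZ.
have := ler_normD (T ((2 * c) *: v) - - c *: T (- (2 *: v)))
  (- c *: (T (- (2 *: v)) + T (2 *: v))).
rewrite (normrZ (- c)) normrN.
have := ler_piMl (normr_ge0 (T (2 *: v) - 2 *: T v)) c1.
have := ler_piMl (normr_ge0 (T (- (2 *: v)) + T (2 *: v))) c1.
lra.
Qed.

(** The midpoint of 2 x v and 2 y w, at distance at most 2, costs 2 eta, and the two halves of the
    homogeneity error cost 7 eta each. *)
Lemma approx_affine_linear (R : realType) (Y X : normedModType R) (eta x y : R)
    (T : Y -> X) (v w : Y) : 0 <= eta -> T 0 = 0 -> approx_affine eta T ->
  `|x| <= 1 -> `|y| <= 1 -> `|v| = 1 -> `|w| = 1 -> `|x *: v - y *: w| <= 1 ->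
  `|T (x *: v + y *: w) - (x *: T v + y *: T w)| <= 16 * eta.
Proof.
move=> eta0 T0 H x1 y1 v1 w1 vw.
have half : 0 <= (2^-1 : R) <= 1 by lra.
have n2 : `|(2 * x) *: v - (2 * y) *: w| <= 2.
  by rewrite -!scalerA -scalerBr normrZ ger0_norm//; lra.
have := H ((2 * x) *: v) ((2 * y) *: w) _ half.
have -> : 1 - 2^-1 = 2^-1 :> R by lra.
rewrite !(scalerA 2^-1) !mulKf// => h.
have hx := approx_affine_homogeneous eta0 x1 v1 T0 H.
have hy := approx_affine_homogeneous eta0 y1 w1 T0 H.
move: h hx hy.
move: (T ((2 * x) *: v)) (T ((2 * y) *: w)) => p q h hx hy.
have -> : T (x *: v + y *: w) - (x *: T v + y *: T w) =
    T (x *: v + y *: w) - (2^-1 *: p + 2^-1 *: q)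
    + 2^-1 *: (p - (2 * x) *: T v) + 2^-1 *: (q - (2 * y) *: T w).
  rewrite !scalerBr !scalerA !mulKf// -addrA -addrA; congr (_ + _).
  by rewrite addrACA -opprD addKr.
apply: le_trans (ler_normD _ _) _.
have := ler_normD (T (x *: v + y *: w) - (2^-1 *: p + 2^-1 *: q))
  (2^-1 *: (p - (2 * x) *: T v)).
have half0 : 0 <= 2^-1 :> R by lra.
rewrite !normrZ (ger0_norm half0).
have := ler_wpM2l eta0 n2; lra.
Qed.

(** * Absence of bendings *)

Lemma klipschitz_continuous (R : realType) (k : R) (g : R -> R) : 0 <= k ->
  (forall x y, `|g x - g y| <= k * `|x - y|) -> continuous g.
Proof.
move=> k0 gk x; apply/cvgrPdist_le => e e0.
(* The constant [k] may be 0, so the division is by [k + 1]. *)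
have k1 : 0 < k + 1 by lra.
have d0 : 0 < e / (k + 1) by rewrite divr_gt0.
near=> y; apply: le_trans (gk _ _) _.
have : `|x - y| <= e / (k + 1) by near: y; exact: cvgr_dist_le.
rewrite ler_pdivlMr// => h; have := normr_ge0 (x - y); nra.
Unshelve. all: by end_near.
Qed.

Section no_bending.
Variable R : realType.

Definition rv2 (x y : R) : l2 R 2 := \row_(i < 2) (if i == ord0 then x else y).

Lemma rv2_norm x y : `|rv2 x y| = Num.sqrt (x ^+ 2 + y ^+ 2).
Proof. by rewrite l2_normE !big_ord_recl big_ord0 addr0 !mxE. Qed.

Lemma rv2D x y x' y' : rv2 x y + rv2 x' y' = rv2 (x + x') (y + y').
Proof. by apply/rowP => i; rewrite !mxE; case: ifP. Qed.

Lemma rv2Z k x y : k *: rv2 x y = rv2 (k * x) (k * y).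
Proof. by apply/rowP => i; rewrite !mxE; case: ifP. Qed.

Lemma rv2_norm1 : `|rv2 1 0| = 1 /\ `|rv2 0 1| = 1.
Proof. by rewrite !rv2_norm expr0n expr1n /= addr0 add0r sqrtr1. Qed.

(** On the unit circle, [x *: u + y *: w] is within 16 eta of the image of a unit vector, so its
    norm is within eps + 16 eta <= 1 of 1; squaring costs the factor 3. Homogeneity extends the
    estimate to all [(x, y)]. *)
Lemma near_isometry_near_euclidean (eps eta : R) (T : l2 R 2 -> bspace R)
    (u := T (rv2 1 0)) (w := T (rv2 0 1)) :
  0 <= eps -> 0 <= eta -> eps + 16 * eta <= 1 -> T 0 = 0 -> approx_affine eta T ->
  (forall v, `|v| = 1 -> `| `|T v| - 1| <= eps) ->
  near_euclidean (3 * (eps + 16 * eta)) (ca1 u) (ca2 u) (cb1 u) (cb2 u)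
    (ca1 w) (ca2 w) (cb1 w) (cb2 w).
Proof.
move=> e0 eta0 small T0 H T1.
have [u1 w1] := rv2_norm1.
have unit x y : x ^+ 2 + y ^+ 2 = 1 ->
    `|Qsq (x *: u + y *: w) - 1| <= 3 * (eps + 16 * eta).
  move=> xy; have [x2 y2] := (sqr_ge0 x, sqr_ge0 y).
  have x1 : `|x| <= 1.
    by rewrite -(@ler_pXn2r _ 2)// ?nnegrE// real_normK ?num_real; lra.
  have y1 : `|y| <= 1.
    by rewrite -(@ler_pXn2r _ 2)// ?nnegrE// real_normK ?num_real; lra.
  have rot z : z ^+ 2 = y ^+ 2 -> `|x *: rv2 1 0 + z *: rv2 0 1| = 1.
    move=> zy; rewrite !rv2Z rv2D !mulr0 !mulr1 addr0 add0r rv2_norm zy xy.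
    by rewrite sqrtr1.
  have le1 : `|x *: rv2 1 0 - y *: rv2 0 1| <= 1.
    by rewrite -scaleNr rot// sqrrN.
  have := approx_affine_linear eta0 T0 H x1 y1 u1 w1 le1.
  have := T1 _ (rot y erefl).
  rewrite -/u -/w -bspace_normE.
  have := lerB_dist (T (x *: rv2 1 0 + y *: rv2 0 1)) (x *: u + y *: w).
  have := lerB_dist (x *: u + y *: w) (T (x *: rv2 1 0 + y *: rv2 0 1)).
  rewrite (distrC (x *: u + y *: w)) !ler_norml.
  have := normr_ge0 (x *: u + y *: w).
  move: `|x *: u + y *: w| `|T _| `|_ - _| => n m d n0 h1 h2 /andP[h3 h4] h5.
  apply/andP; split; nra.
move=> x y; rewrite -!ca1Z -!ca2Z -!cb1Z -!cb2Z -ca1D -ca2D -cb1D -cb2D -/(Qsq _).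
pose n := Num.sqrt (x ^+ 2 + y ^+ 2).
have nn : n ^+ 2 = x ^+ 2 + y ^+ 2 by rewrite sqr_sqrtr// addr_ge0 ?sqr_ge0.
rewrite -nn; have [n0|n0] := eqVneq n 0.
  move: nn; rewrite n0 expr0n/= => xy.
  have [x0 y0] : x ^+ 2 = 0 /\ y ^+ 2 = 0.
    by have := sqr_ge0 x; have := sqr_ge0 y; split; lra.
  move/eqP: x0; rewrite sqrf_eq0 => /eqP ->.
  move/eqP: y0; rewrite sqrf_eq0 => /eqP ->.
  rewrite !scale0r addr0 -bspace_normE normr0 expr0n/= subr0 normr0 mulr0; lra.
have -> : x *: u + y *: w = n *: ((x / n) *: u + (y / n) *: w).
  by rewrite scalerDr !scalerA !(mulrC n) !divfK.
rewrite QsqZ -[X in `|_ - X|]mulr1 -mulrBr normrM ger0_norm ?sqr_ge0// mulrC.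
rewrite ler_wpM2r ?sqr_ge0// unit// !expr_div_n -mulrDl -nn divff//.
by rewrite expf_eq0 negb_and n0 orbT.
Qed.

Lemma no_near_isometry (eps : R) (T : l2 R 2 -> bspace R) :
  0 <= eps <= (1 / 1000) ^+ 8 / 8 ->
  (forall x y, `|T x - T y| <= (1 + eps) * `|x - y|) ->
  (forall x y, `|x - y| <= (1 + eps) * `|T x - T y|) ->
  T 0 = 0 -> ca1 (T (rv2 1 0)) ^+ 2 + ca2 (T (rv2 1 0)) ^+ 2 = 1 / 4 -> False.
Proof.
move=> /andP[e0 e1] Tlip Tinv T0.
(* With eta = 10^-12 this gives 5 eps <= eta^2, and 3 (eps + 16 eta) stays below the tolerance 10^-9
   = 1000 eta. *)
have {}e1 : eps <= ((1 / 1000) ^+ 4) ^+ 2 / 8 by rewrite -exprM.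
have eta0 : 0 < (1 / 1000 : R) ^+ 4 by apply: exprn_gt0; lra.
have eta1 : (1 / 1000 : R) ^+ 4 = (1 / 1000) * (1 / 1000) ^+ 3 by rewrite exprS.
have dl1 : (1 / 1000 : R) ^+ 3 <= 1 / 1000 by lra.
move: e1 eta0 eta1; set eta := (1 / 1000) ^+ 4 => e1 eta0 eta1.
have eta2 : eta ^+ 2 <= eta by rewrite expr2 ler_piMl; lra.
have H : approx_affine eta T.
  by apply: bilipschitz_approx_affine Tlip Tinv; have := sqr_ge0 eta; lra.
have := @near_isometry_near_euclidean eps eta T e0 (ltW eta0) _ T0 H _.
move=> /(_ ltac:(lra)) K.
apply: near_euclidean_mixed_false => x y.
apply: le_trans (K _ x y) _.
  move=> v v1; have := Tlip v 0; have := Tinv v 0.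
  rewrite T0 !subr0 v1 ler_norml => h1 h2; have := normr_ge0 (T v) => h3.
  apply/andP; split; nra.
by rewrite ler_wpM2r ?addr_ge0 ?sqr_ge0//; lra.
Qed.

(** Only the product of the two Lipschitz constants is bounded by [C]. As [T] is isometric on the
    inner ball, each of them is at least 1, so each is at most [C]. *)
Lemma bending_bilipschitz (Y X : completeNormedModType R) (C r rho : R)
    (I1 I2 : {linear Y -> X}) (T : Y -> X) (e : Y) :
  0 < r -> `|e| = 1 -> isometric_embedding I1 -> bending C r rho I1 I2 T ->
  [/\ forall x y, `|T x - T y| <= C * `|x - y|,
      forall x y, `|x - y| <= C * `|T x - T y| & T 0 = 0].
Proof.
move=> r0 e1 iso1 [[S [TK TLip SLip]] + T1 _].
have [k1 [-> k10 Tk]] := LipP TLip; have [k2 [-> k20 Sk]] := LipP SLip.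
rewrite -EFinM lee_fin => k12.
have T0 : T 0 = 0 by rewrite T1 ?normr0 ?linear0// ltW.
have re : `|r *: e| = r by rewrite normrZ e1 mulr1 gtr0_norm.
have Tr : `|T (r *: e)| = r by rewrite T1 ?re// iso1.
have k11 : 1 <= k1.
  by have := Tk (r *: e) 0 I I; rewrite T0 !subr0 Tr re ler_pMl.
have k21 : 1 <= k2.
  have := Sk (T (r *: e)) (T 0) (ex_intro2 _ _ _ I erefl) (ex_intro2 _ _ _ I erefl).
  by rewrite !TK T0 !subr0 Tr re ler_pMl.
split=> // x y.
  apply: le_trans (Tk x y I I) _; rewrite ler_wpM2r// (le_trans _ k12)//.
  by rewrite ler_peMr.
have := Sk (T x) (T y) (ex_intro2 _ _ _ I erefl) (ex_intro2 _ _ _ I erefl).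
rewrite !TK => /le_trans; apply; rewrite ler_wpM2r// (le_trans _ k12)//.
by rewrite ler_peMl.
Qed.

Lemma no_bending (eps r rho : R) (I1 I2 : {linear l2 R 2 -> bspace R})
    (T : l2 R 2 -> bspace R) :
  0 <= eps <= (1 / 1000) ^+ 8 / 8 -> 0 < r -> r < rho ->
  isometric_embedding I1 ->
  (forall y, I1 y \in plane1 R) -> (forall y, I2 y \in plane2 R) ->
  ~ bending (1 + eps) r rho I1 I2 T.
Proof.
move=> he r0 rrho iso1 I1Y I2Y bT; have [e1 _] := rv2_norm1.
have [Tlip Tinv T0] := bending_bilipschitz r0 e1 iso1 bT.
have [_ T1 T2] := bT.
have C0 : 0 <= 1 + eps by lra.
pose c s := T (s *: rv2 1 0).
have c_lip s s' : `|c s - c s'| <= (1 + eps) * `|s - s'|.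
  by apply: le_trans (Tlip _ _) _; rewrite -scalerBl normrZ e1 mulr1.
have ca1c : continuous (fun s => ca1 (c s)).
  apply: klipschitz_continuous C0 _ => s s'; apply: le_trans (c_lip s s').
  by case: (norm_coord_le (c s - c s')).
have ca2c : continuous (fun s => ca2 (c s)).
  apply: klipschitz_continuous C0 _ => s s'; apply: le_trans (c_lip s s').
  by case: (norm_coord_le (c s - c s')).
(* A zero of [f] is a scale at which the first component of [c s] has norm s / 2. The value is 3 r^2
   / 4 at [r] and - rho^2 / 4 at [rho]. *)
pose f s := ca1 (c s) ^+ 2 + ca2 (c s) ^+ 2 - s ^+ 2 / 4.
have fc : continuous f.
  have sqrc (g : R -> R) : continuous g -> continuous (fun s => g s ^+ 2).
    by move=> gc s; apply: (@continuous_comp _ _ _ g (fun z : R => z ^+ 2));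
      [exact: gc|exact: exprn_continuous].
  move=> s; apply: cvgB; first by apply: cvgD; exact: sqrc.
  by apply: cvgMl; exact: exprn_continuous.
have fr : f r = r ^+ 2 - r ^+ 2 / 4.
  rewrite /f /c T1 ?normrZ ?e1 ?mulr1 ?gtr0_norm//; congr (_ - _).
  have : `|I1 (r *: rv2 1 0)| ^+ 2 = r ^+ 2.
    by rewrite iso1 normrZ e1 mulr1 gtr0_norm.
  have := I1Y (r *: rv2 1 0); rewrite mem_plane1.
  case: (I1 (r *: rv2 1 0)) => a b /= /eqP ->.
  by rewrite norm_plane1.
have rho0 : 0 < rho by lra.
have frho : f rho = - (rho ^+ 2 / 4).
  rewrite /f /c T2 ?normrZ ?e1 ?mulr1 ?gtr0_norm//.
  have := I2Y (rho *: rv2 1 0); rewrite mem_plane2 /ca1 /ca2 => /eqP ->.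
  by rewrite /= expr0n addr0 sub0r.
have [r2 rho2] : 0 < r ^+ 2 /\ 0 < rho ^+ 2 by rewrite !exprn_gt0.
have [|s] := @IVT R f r rho 0 (ltW rrho) (continuous_subspaceT fc).
  by rewrite fr frho ge_min le_max; apply/andP; split; apply/orP; [right|left]; lra.
rewrite in_itv /= => /andP[rs _] fs.
have s0 : 0 < s by lra.
(* Conjugating by the dilation of ratio [s] preserves both Lipschitz bounds and moves the scale [s]
   to 1. *)
apply: (@no_near_isometry eps (fun v => s^-1 *: T (s *: v)) he).
- move=> x y; rewrite -scalerBr normrZ gtr0_norm ?invr_gt0// mulrC ler_pdivrMr//.
  by apply: le_trans (Tlip _ _) _; rewrite -scalerBr normrZ gtr0_norm// (mulrC s) mulrA.
- move=> x y; rewrite -scalerBr normrZ gtr0_norm ?invr_gt0// mulrCA mulrC ler_pdivlMr//.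
  apply: le_trans (Tinv _ _); rewrite -scalerBr normrZ gtr0_norm// mulrC//.
- by rewrite scaler0 T0 scaler0.
- rewrite ca1Z ca2Z -/(c s) !exprMn -mulrDr.
  have -> : ca1 (c s) ^+ 2 + ca2 (c s) ^+ 2 = s ^+ 2 / 4 by move: fs; rewrite /f; lra.
  by field; rewrite gt_eqF.
Qed.

End no_bending.

Theorem theorem5p1 (R : realType) :
  exists (X : finBanachType R) (Y1 Y2 : {vspace X}),
    [/\ \dim {:X} = 4%N,
      [/\ (Y1 + Y2)%VS = fullv, directv (Y1 + Y2),
        \dim Y1 = 2%N & \dim Y2 = 2%N],
      euclidean_subspace Y1 /\ euclidean_subspace Y2,
      opnorm (daddv_pi Y1 Y2) = 1%E /\ opnorm (daddv_pi Y2 Y1) = 1%E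
      & exists2 eps : R, 0 < eps &
        forall r rho : R, 0 < r -> r < rho ->
        forall I1 I2 : {linear l2 R 2 -> X},
          isometric_embedding I1 -> isometric_embedding I2 ->
          (forall y, I1 y \in Y1) -> (forall y, I2 y \in Y2) ->
          ~ exists T : l2 R 2 -> X, bending (1 + eps) r rho I1 I2 T].
Proof.
have [d1 d2] := dim_plane R.
exists (bspace R : finBanachType R), (plane1 R), (plane2 R); split.
- exact: dim_bspace.
- by split=> //; [exact: plane_add|apply/directv_addP; exact: plane_cap].
- exact: euclidean_plane.
- exact: opnorm_plane.
have eps0 : 0 < (1 / 1000 : R) ^+ 8 / 8.
  by apply: divr_gt0; [apply: exprn_gt0|]; lra.
exists ((1 / 1000) ^+ 8 / 8); first exact: eps0.
move=> r rho r0 rrho I1 I2 iso1 _ I1Y I2Y [T bT].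
apply: no_bending r0 rrho iso1 I1Y I2Y bT.
by apply/andP; split; [exact: ltW eps0|exact: lexx].
Qed.
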